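(* Let $L$ be a non-Lie complex filiform Leibniz algebra in $FLeib_6$. Then $L$ is isomorphic to one of the following pairwise non-isomorphic Leibniz algebras (basis $e_0,\dots,e_5$; products of basis vectors not listed are zero; in all cases $e_0e_0=e_2$ and $e_ie_0=e_{i+1}$ for $1\le i\le 4$; within parametric families, different parameter values give non-isomorphic algebras): 1) $L(1,0,\lambda_1,\lambda_2)$, $\lambda_1,\lambda_2\in\mathbb{C}$: $e_0e_1=e_3+\lambda_2e_5$, $e_1e_1=e_3+\lambda_1e_5$, $e_2e_1=e_4$, $e_3e_1=e_5$; 2) $L(1,-2,\lambda,2\lambda-5)$, $\lambda\in\mathbb{C}$: $e_0e_1=e_3-2e_4+(2\lambda-5)e_5$, $e_1e_1=e_3-2e_4+\lambda e_5$, $e_2e_1=e_4-2e_5$, $e_3e_1=e_5$; 3) $L(0,1,1,\lambda)$, $\lambda\in\mathbb{C}$: $e_0e_1=e_4+\lambda e_5$, $e_1e_1=e_4+e_5$, $e_2e_1=e_5$; 4) $L(1,-2,0,0)$: $e_0e_1=e_3-2e_4$, $e_1e_1=e_3-2e_4$, $e_2e_1=e_4-2e_5$, $e_3e_1=e_5$; 5) $L(1,-2,5,0)$: $e_0e_1=e_3-2e_4$, $e_1e_1=e_3-2e_4+5e_5$, $e_2e_1=e_4-2e_5$, $e_3e_1=e_5$; 6) $L(0,1,0,1)$: $e_0e_1=e_4+e_5$, $e_1e_1=e_4$, $e_2e_1=e_5$; 7) $L(0,1,0,0)$: $e_0e_1=e_4$, $e_1e_1=e_4$, $e_2e_1=e_5$;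 8) $L(0,0,1,0)$: $e_1e_1=e_5$; 9) $L(0,0,1,1)$: $e_0e_1=e_5$, $e_1e_1=e_5$; 10) $L(0,0,0,1)$: $e_0e_1=e_5$; 11) $L(0,0,0,0)$: no further nonzero products.
   Context: All algebras are over $\mathbb{C}$. A Leibniz algebra is an algebra (with bilinear product) satisfying $x(yz)=(xy)z-(xz)y$. With $L^1=L$ and $L^{k+1}=L^kL$, an $m$-dimensional Leibniz algebra is filiform if $\dim L^i=m-i$ for $2\le i\le m$. For $(\alpha_3,\alpha_4,\alpha_5,\theta)\in\mathbb{C}^4$, $L(\alpha_3,\alpha_4,\alpha_5,\theta)$ denotes the $6$-dimensional (filiform, non-Lie) Leibniz algebra with basis $e_0,\dots,e_5$ and nonzero products $e_0e_0=e_2$, $e_ie_0=e_{i+1}$ ($1\le i\le 4$), $e_0e_1=\alpha_3e_3+\alpha_4e_4+\theta e_5$, $e_1e_1=\alpha_3e_3+\alpha_4e_4+\alpha_5e_5$, $e_2e_1=\alpha_3e_4+\alpha_4e_5$, $e_3e_1=\alpha_3e_5$. $FLeib_6$ is the class of all algebras $L(\alpha_3,\alpha_4,\alpha_5,\theta)$. *)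

(* Defs.v *)
From HB Require Import structures.
From mathcomp Require Import all_boot all_order all_algebra.
From mathcomp Require Import ring.
From mathcomp Require Export reals complex.

Set Implicit Arguments.
Unset Strict Implicit.
Unset Printing Implicit Defensive.

Import GRing.Theory.
Local Open Scope ring_scope.

(* Right Leibniz algebras; only finite-dimensional ones are considered, hence
   the underlying vectType. *)
HB.mixin Record Vector_isLeibniz (K : fieldType) (V : Type)
    of Vector K V := {
  lmul : V -> V -> V;
  lmul_bilinear : bilinear_for *:%R *:%R lmul;
  lmul_leibniz : forall x y z : V,
    lmul x (lmul y z) = lmul (lmul x y) z - lmul (lmul x z) y
}.

#[short(type="leibnizAlgType")]
HB.structure Definition LeibnizAlg (K : fieldType) :=
  { V of Vector_isLeibniz K V & Vector K V }.

HB.instance Definition _ (K : fieldType) (L : leibnizAlgType K) :=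
  bilinear_isBilinear.Build K L L L *:%R *:%R (@lmul K L) lmul_bilinear.

Definition is_lie (K : fieldType) (L : leibnizAlgType K) : Prop :=
  (forall x : L, lmul x x = 0) /\
  (forall x y z : L,
     lmul x (lmul y z) + lmul y (lmul z x) + lmul z (lmul x y) = 0).

(* The linear span of all products u v with u in U and v in V, encoded through
   bases of U and V as prodv is for falgType. *)
Definition lprodv (K : fieldType) (L : leibnizAlgType K) (U V : {vspace L}) :
    {vspace L} :=
  <<[seq lmul u v | u <- vbasis U, v <- vbasis V]>>%VS.

(* The power L^k, numbered from L^1 = L (so that the value at k = 0 is junk). *)
Definition lpower (K : fieldType) (L : leibnizAlgType K) (k : nat) :
    {vspace L} :=
  iter k.-1 (fun U => lprodv U fullv) fullv.

Definition filiform (K : fieldType) (m : nat) (L : leibnizAlgType K) : Prop :=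
  \dim {:L} = m /\ forall i, (2 <= i <= m)%N -> \dim (lpower L i) = (m - i)%N.

Definition leib_iso (K : fieldType) (L L' : leibnizAlgType K) : Prop :=
  exists f : {linear L -> L'}, bijective f /\ {morph f : x y / lmul x y}.

(* The row vector with a single 1 in position k, meant for k < 6. *)
Definition ebasis (K : fieldType) (k : nat) : 'rV[K]_6 := delta_mx 0 (inord k).

Definition FL_table (K : fieldType) (a3 a4 a5 theta : K) (i j : nat) :
    'rV[K]_6 :=
  let e := @ebasis K in
  match i, j with
  | 0, 0 => e 2
  | 1, 0 => e 2
  | 2, 0 => e 3
  | 3, 0 => e 4
  | 4, 0 => e 5
  | 0, 1 => a3 *: e 3 + a4 *: e 4 + theta *: e 5
  | 1, 1 => a3 *: e 3 + a4 *: e 4 + a5 *: e 5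
  | 2, 1 => a3 *: e 4 + a4 *: e 5
  | 3, 1 => a3 *: e 5
  | _, _ => 0
  end.

Definition FL_mul (K : fieldType) (a3 a4 a5 theta : K) (x y : 'rV[K]_6) :
    'rV[K]_6 :=
  \sum_(i < 6) \sum_(j < 6) (x 0 i * y 0 j) *: FL_table a3 a4 a5 theta i j.

Lemma FL_mul_bilinear (K : fieldType) (a3 a4 a5 theta : K) :
  bilinear_for *:%R *:%R (FL_mul a3 a4 a5 theta).
Proof.
split=> [u a x y|u a x y] /=; rewrite /FL_mul scaler_sumr -big_split /=;
  apply: eq_bigr => i _; rewrite scaler_sumr -big_split /=;
  apply: eq_bigr => j _; rewrite !mxE scalerA -scalerDl; congr (_ *: _); ring.
Qed.

Lemma FL_mul_ebasis (K : fieldType) (a3 a4 a5 theta : K) (i j : nat) :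
  (i < 6)%N -> (j < 6)%N ->
  FL_mul a3 a4 a5 theta (ebasis K i) (ebasis K j) = FL_table a3 a4 a5 theta i j.
Proof.
move=> lti ltj; rewrite /FL_mul (bigD1 (inord i)) //= (bigD1 (inord j)) //=.
rewrite !mxE !eqxx mulr1 scale1r !inordK // !big1 ?addr0 // => k ki.
  by rewrite big1 // => l _; rewrite !mxE (negPf ki) mul0r scale0r.
by rewrite !mxE (negPf ki) mulr0 scale0r.
Qed.

Lemma FL_mulE (K : fieldType) (a3 a4 a5 theta : K) (x y : 'rV[K]_6) :
  let X i := x 0 (inord i) in let Y i := y 0 (inord i) in
  FL_mul a3 a4 a5 theta x y =
    (X 0 * Y 0 + X 1 * Y 0) *: ebasis K 2
  + (X 2 * Y 0 + (X 0 + X 1) * Y 1 * a3) *: ebasis K 3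
  + (X 3 * Y 0 + (X 0 + X 1) * Y 1 * a4 + X 2 * Y 1 * a3) *: ebasis K 4
  + (X 4 * Y 0 + X 0 * Y 1 * theta + X 1 * Y 1 * a5 + X 2 * Y 1 * a4
     + X 3 * Y 1 * a3) *: ebasis K 5.
Proof.
move=> X Y.
have -> : FL_mul a3 a4 a5 theta x y =
    \sum_(i < 6) \sum_(j < 6) (X i * Y j) *: FL_table a3 a4 a5 theta i j.
  by apply: eq_bigr => i _; apply: eq_bigr => j _; rewrite /X /Y !inord_val.
rewrite !big_ord_recl !big_ord0 !lift0 /=.
move: X Y (ebasis K 2) (ebasis K 3) (ebasis K 4) (ebasis K 5).
move=> X Y e2 e3 e4 e5.
rewrite !scaler0 !addr0.
move: (X _) (X _) (X _) (X _) (X _) (Y _) (Y _) => X0 X1 X2 X3 X4 Y0 Y1.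
apply/rowP=> k; rewrite !mxE.
move: (e2 0 k) (e3 0 k) (e4 0 k) (e5 0 k) => u2 u3 u4 u5.
ring.
Qed.

Lemma FL_mul_leibniz (K : fieldType) (a3 a4 a5 theta : K) (x y z : 'rV[K]_6) :
  let m := FL_mul a3 a4 a5 theta in m x (m y z) = m (m x y) z - m (m x z) y.
Proof.
pose X (v : 'rV[K]_6) i := v 0 (inord i).
have XD k (v w : 'rV[K]_6) : X (v + w) k = X v k + X w k by rewrite /X mxE.
have XZ k a (w : 'rV[K]_6) : X (a *: w) k = a * X w k by rewrite /X mxE.
have Xe i k : (i < 6)%N -> (k < 6)%N -> X (ebasis K i) k = (k == i)%:R.
  by move=> lti ltk; rewrite /X mxE eqxx /= -val_eqE /= !inordK.
move=> m.
have Xm v w : (X (m v w) 0 = 0) * (X (m v w) 1 = 0)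
    * (X (m v w) 2 = X v 0 * X w 0 + X v 1 * X w 0)
    * (X (m v w) 3 = X v 2 * X w 0 + (X v 0 + X v 1) * X w 1 * a3)
    * (X (m v w) 4 = X v 3 * X w 0 + (X v 0 + X v 1) * X w 1 * a4
                     + X v 2 * X w 1 * a3).
  by rewrite /m FL_mulE !(XD, XZ) !Xe //= !(mulr0, mulr1, addr0, add0r).
have mE v w : m v w = _ := FL_mulE a3 a4 a5 theta v w.
rewrite (mE x (m y z)) (mE (m x y) z) (mE (m x z) y) -!/(X _ _) !Xm {mE Xm}.
move: (X x) (X y) (X z) => {}x {}y {}z.
move: (ebasis K 2) (ebasis K 3) (ebasis K 4) (ebasis K 5) => e2 e3 e4 e5.
by apply/rowP=> k; rewrite !mxE; ring.
Qed.

(* L(a3, a4, a5, theta). The carrier ignores the parameters, which only key the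
   product instance; FL_mul_ebasis recovers the multiplication table. *)
Definition FL (K : fieldType) (a3 a4 a5 theta : K) : Type := 'rV[K]_6.

HB.instance Definition _ (K : fieldType) (a3 a4 a5 theta : K) :=
  Vector.copy (FL a3 a4 a5 theta) 'rV[K]_6.
HB.instance Definition _ (K : fieldType) (a3 a4 a5 theta : K) :=
  Vector_isLeibniz.Build K (FL a3 a4 a5 theta)
    (@FL_mul_bilinear K a3 a4 a5 theta) (@FL_mul_leibniz K a3 a4 a5 theta).

(* Membership in the class FLeib_6, which is understood up to isomorphism. *)
Definition in_FLeib6 (K : fieldType) (L : leibnizAlgType K) : Prop :=
  exists a3 a4 a5 theta : K, leib_iso L (FL a3 a4 a5 theta).

Inductive FLeib6_index (K : fieldType) : Type :=
  | Fam1 (lambda1 lambda2 : K)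
  | Fam2 (lambda : K)
  | Fam3 (lambda : K)
  | Alg4 | Alg5 | Alg6 | Alg7 | Alg8 | Alg9 | Alg10 | Alg11.

Definition FLeib6_rep (K : fieldType) (t : FLeib6_index K) :
    leibnizAlgType K :=
  match t with
  | Fam1 lambda1 lambda2 => FL 1 0 lambda1 lambda2
  | Fam2 lambda => FL 1 (- 2) lambda (2 * lambda - 5)
  | Fam3 lambda => FL 0 1 1 lambda
  | Alg4 => FL 1 (- 2) 0 0
  | Alg5 => FL 1 (- 2) 5 0
  | Alg6 => FL 0 1 0 1
  | Alg7 => FL 0 1 0 0
  | Alg8 => FL 0 0 1 0
  | Alg9 => FL 0 0 1 1
  | Alg10 => FL 0 0 0 1
  | Alg11 => FL 0 0 0 0
  end.

(* Main.v *)
(* An isomorphism L(s) -> L(t) sends e_0 to A e_0 + (c - A) e_1 and e_1 to c e_1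
   modulo L^2, with A c != 0; the coordinates in L^2 turn out to be irrelevant,
   and s is an explicit function of A, c and t.  Conversely every
   such pair (A, c) is realised by a triangular change of basis.  Put
   w = alpha_4 + 2 alpha_3^2, u = alpha_5 - 5 alpha_3^3, d = theta - alpha_5.
   Then alpha_3, w and d only get rescaled, and so does u when alpha_3 w = 0;
   the classification is the list of orbits of these rescalings. *)
Require Import Defs.
From mathcomp Require Import all_boot all_order all_algebra reals complex.
From mathcomp Require Import ring.
Import Order.TTheory GRing.Theory Num.Theory.
Local Open Scope ring_scope.
Local Open Scope complex_scope.

(** * Composition of isomorphisms, and coordinates of products *)

Lemma leib_iso_trans (K : fieldType) (L1 L2 L3 : leibnizAlgType K) :
  leib_iso L1 L2 -> leib_iso L2 L3 -> leib_iso L1 L3.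
Proof.
move=> [f [bf mf]] [g [bg mg]]; exists (g \o f : {linear _ -> _}).
by split=> [|x y]; [exact: bij_comp | rewrite /= mf mg].
Qed.

Definition coord6 {K : fieldType} (v : 'rV[K]_6) (k : nat) : K := v 0 (inord k).

Lemma coord6_inj (K : fieldType) (v w : 'rV[K]_6) :
  (forall k, (k < 6)%N -> coord6 v k = coord6 w k) -> v = w.
Proof.
move=> vw; apply/rowP=> i; have := vw i (ltn_ord i).
by rewrite /coord6 inord_val.
Qed.

Lemma coord6D (K : fieldType) (v w : 'rV[K]_6) k :
  coord6 (v + w) k = coord6 v k + coord6 w k.
Proof. by rewrite /coord6 mxE. Qed.

Lemma coord6Z (K : fieldType) a (v : 'rV[K]_6) k :
  coord6 (a *: v) k = a * coord6 v k.
Proof. by rewrite /coord6 mxE. Qed.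

Lemma coord6_ebasis (K : fieldType) i k : (i < 6)%N -> (k < 6)%N ->
  coord6 (ebasis K i) k = (k == i)%:R.
Proof. by move=> lti ltk; rewrite /coord6 mxE eqxx /= -val_eqE /= !inordK. Qed.

Lemma coord6_mul (K : fieldType) (a3 a4 a5 theta : K) (x y : 'rV[K]_6) :
  let m := FL_mul a3 a4 a5 theta x y in
  let X := coord6 x in let Y := coord6 y in
  (coord6 m 0 = 0) * (coord6 m 1 = 0)
  * (coord6 m 2 = (X 0 + X 1) * Y 0)
  * (coord6 m 3 = X 2 * Y 0 + (X 0 + X 1) * Y 1 * a3)
  * (coord6 m 4 = X 3 * Y 0 + (X 0 + X 1) * Y 1 * a4 + X 2 * Y 1 * a3)
  * (coord6 m 5 = X 4 * Y 0 + X 0 * Y 1 * theta + X 1 * Y 1 * a5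
                  + X 2 * Y 1 * a4 + X 3 * Y 1 * a3).
Proof.
move=> m X Y; rewrite /m FL_mulE !(coord6D, coord6Z) !coord6_ebasis //=.
by rewrite !(mulr0, mulr1, addr0, add0r) -/(X _) mulrDl.
Qed.

(** * Sufficiency: every pair (A, c) with A c != 0 gives an isomorphism *)

(* Parameters of L(t3, t4, t5, th) read off in the basis generated by
   e_0' = A e_0 + (c - A) e_1 and e_1' = c e_1 + (c - A) (th - t5) e_4. *)
Definition FL_base_change {K : fieldType} (A c t3 t4 t5 th : K) :
    K * K * K * K :=
  let B := c - A in
  let s5 := c * (A ^+ 2 * t5 - 5 * A * B * t3 * t4 + 5 * B ^+ 2 * t3 ^+ 3)
            / A ^+ 6 in
  (c * t3 / A ^+ 2, c * (A * t4 - 2 * B * t3 ^+ 2) / A ^+ 4,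
   s5, s5 + (th - t5) / A ^+ 3).

Section BaseChange.
Variables (K : fieldType) (A c t3 t4 t5 th : K).
Hypotheses (A0 : A != 0) (c0 : c != 0).
Let B := c - A.

(** The rows are e_0', ..., e_5', where e_2' = e_0' e_0' and e_{i+1}' = e_i' e_0' for i >= 2. The
    e_4 entry of the row of e_1' is what makes e_1' e_0' = e_0' e_0'. *)
Definition base_change_mx : 'M[K]_6 :=
  let rows :=
   [:: [:: A; B; 0; 0; 0; 0];
       [:: 0; c; 0; 0; B * (th - t5); 0];
       [:: 0; 0; A * c; c * B * t3; c * B * t4; A * B * th + B ^+ 2 * t5];
       [:: 0; 0; 0; A ^+ 2 * c; 2 * A * c * B * t3;
           2 * A * c * B * t4 + c * B ^+ 2 * t3 ^+ 2];
       [:: 0; 0; 0; 0; A ^+ 3 * c; 3 * A ^+ 2 * c * B * t3];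
       [:: 0; 0; 0; 0; 0; A ^+ 4 * c]] in
  \matrix_(i, j) nth 0 (nth [::] rows i) j.

Lemma base_change_mx_unit : base_change_mx \in unitmx.
Proof.
rewrite unitmxE -det_tr det_trig; last first.
  apply/is_trig_mxP=> i j; rewrite !mxE.
  by case: i j => [[|[|[|[|[|[|i]]]]]] //= _] [[|[|[|[|[|[|j]]]]]] //= _].
rewrite !big_ord_recl big_ord0 !mxE /= mulr1 unitfE.
by rewrite !mulf_neq0 ?expf_neq0.
Qed.

Lemma coord6_base_change (x : 'rV[K]_6) :
  let y := x *m base_change_mx in let X := coord6 x in
  (coord6 y 0 = X 0 * A) * (coord6 y 1 = X 0 * B + X 1 * c)
  * (coord6 y 2 = X 2 * (A * c))
  * (coord6 y 3 = X 2 * (c * B * t3) + X 3 * (A ^+ 2 * c))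
  * (coord6 y 4 = X 1 * (B * (th - t5)) + X 2 * (c * B * t4)
       + X 3 * (2 * A * c * B * t3) + X 4 * (A ^+ 3 * c))
  * (coord6 y 5 = X 2 * (A * B * th + B ^+ 2 * t5)
       + X 3 * (2 * A * c * B * t4 + c * B ^+ 2 * t3 ^+ 2)
       + X 4 * (3 * A ^+ 2 * c * B * t3) + X 5 * (A ^+ 4 * c)).
Proof.
move=> y X.
have E k : (k < 6)%N -> coord6 y k =
    \sum_(i < 6) X i * base_change_mx i (inord k).
  by move=> k6; rewrite /coord6 mxE; apply: eq_bigr => i _;
     rewrite /X /coord6 inord_val.
by rewrite !E // !big_ord_recl !big_ord0 !mxE !inordK //=;
   rewrite !(mulr0, addr0, add0r) ?addrA.
Qed.

Lemma FL_base_change_iso (s3 s4 s5 sh : K) :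
  (s3, s4, s5, sh) = FL_base_change A c t3 t4 t5 th ->
  leib_iso (FL s3 s4 s5 sh) (FL t3 t4 t5 th).
Proof.
case=> -> -> -> ->.
exists (mulmxr base_change_mx : {linear 'rV[K]_6 -> 'rV[K]_6}); split.
  by exists (mulmxr (invmx base_change_mx)) => x /=;
    rewrite ?mulmxK ?mulmxKV ?base_change_mx_unit.
move=> x y; rewrite /= /lmul /=; apply: coord6_inj => k.
case: k => [|[|[|[|[|[|]]]]]] // _;
  rewrite !(coord6_mul, coord6_base_change) /B; try by ring.
- by field.
- by field.
- by field.
Qed.
End BaseChange.

(** * Necessity: every isomorphism comes from a pair (A, c) *)

(** Multiplication by e_0 determines the images of e_2, ..., e_5 from that of e_0. Then e_1 e_0 =
    e_0 e_0 ties the image of e_1 to that of e_0, and the e_5 coordinates of the products by e_1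
    give the four parameters one after the other. *)
Lemma FL_iso_base_change (K : fieldType) (s3 s4 s5 sh t3 t4 t5 th : K) :
  leib_iso (FL s3 s4 s5 sh) (FL t3 t4 t5 th) ->
  exists A c : K, [/\ A != 0, c != 0 &
    (s3, s4, s5, sh) = FL_base_change A c t3 t4 t5 th].
Proof.
case=> f [bf mf].
pose g (x : 'rV[K]_6) : 'rV[K]_6 := f x.
have gD x y : g (x + y) = g x + g y := linearD f x y.
have gZ a x : g (a *: x) = a *: g x := linearZZ f a x.
pose e := @ebasis K.
have gm i j : (i < 6)%N -> (j < 6)%N ->
    g (FL_table s3 s4 s5 sh i j) = FL_mul t3 t4 t5 th (g (e i)) (g (e j)).
  by move=> i6 j6; rewrite -FL_mul_ebasis //; exact: mf.
have g5 : g (e 5%N) != 0.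
  apply/eqP=> g50; have /(bij_inj bf) e50 : f (e 5%N : FL s3 s4 s5 sh) = f 0.
    by rewrite linear0; exact: g50.
  have := coord6_ebasis K 5 5 isT isT; rewrite -/(e 5%N) e50 /coord6 mxE.
  by move/esym/eqP; rewrite oner_eq0.
have e2 := gm 0%N 0%N isT isT; have e3 := gm 2%N 0%N isT isT.
have e4 := gm 3%N 0%N isT isT; have e5 := gm 4%N 0%N isT isT.
have e10 := gm 1%N 0%N isT isT; have e31 := gm 3%N 1%N isT isT.
have e21 := gm 2%N 1%N isT isT; have e11 := gm 1%N 1%N isT isT.
have e01 := gm 0%N 1%N isT isT.
rewrite /= -/e in e2 e3 e4 e5 e10 e31 e21 e11 e01.
rewrite !(gD, gZ) in e31 e21 e11 e01.
pose X := coord6 (g (e 0%N)); pose Y := coord6 (g (e 1%N)).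
have P2 := coord6_mul _ t3 t4 t5 th (g (e 0%N)) (g (e 0%N)).
have P3 := coord6_mul _ t3 t4 t5 th (g (e 2%N)) (g (e 0%N)).
have P4 := coord6_mul _ t3 t4 t5 th (g (e 3%N)) (g (e 0%N)).
have P5 := coord6_mul _ t3 t4 t5 th (g (e 4%N)) (g (e 0%N)).
cbv zeta in P2, P3, P4, P5.
rewrite -e2 -/X in P2; rewrite -e3 -/X !P2 in P3.
rewrite -e4 -/X !P3 in P4; rewrite -e5 -/X !P4 in P5.
rewrite !(mul0r, add0r, addr0) in P3 P4 P5.
pose A := X 0%N; pose c := X 0%N + X 1%N.
(* A ^+ 4 * c is the only possibly nonzero coordinate of the image of e_5. *)
have Ac0 : A ^+ 4 * c != 0.
  apply: contra g5 => /eqP Ac0; apply/eqP; apply: coord6_inj => k.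
  rewrite {2}/coord6 mxE; case: k => [|[|[|[|[|[|]]]]]] // _; rewrite P5 //.
  by rewrite -[RHS]Ac0 /A /c; ring.
have [A0 c0] : A != 0 /\ c != 0.
  by move: Ac0; rewrite mulf_eq0 expf_eq0 /= negb_or => /andP.
have cf k (u v : 'rV[K]_6) : u = v -> coord6 u k = coord6 v k by move=> ->.
(* [qijk] compares the coordinates of index k in the image of e_i e_j. *)
have q102 := cf 2%N _ _ e10; have q103 := cf 3%N _ _ e10.
have q104 := cf 4%N _ _ e10; have q105 := cf 5%N _ _ e10.
have q112 := cf 2%N _ _ e11; have q115 := cf 5%N _ _ e11.
have q015 := cf 5%N _ _ e01; have q215 := cf 5%N _ _ e21.
have q315 := cf 5%N _ _ e31.
rewrite coord6_mul P2 -/X -/Y in q102.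
rewrite coord6_mul P2 -/X -/Y in q103.
rewrite coord6_mul P2 -/X -/Y in q104.
rewrite coord6_mul P2 -/X -/Y in q105.
rewrite !(coord6D, coord6Z) coord6_mul !(P3, P4, P5) -/Y in q112.
rewrite !(mulr0, addr0) in q112.
rewrite !(coord6D, coord6Z) coord6_mul P3 P4 P5 -/X -/Y in q115.
rewrite !(coord6D, coord6Z) coord6_mul P3 P4 P5 -/X -/Y in q015.
rewrite !(coord6D, coord6Z) coord6_mul !P2 P4 P5 -/X -/Y in q215.
rewrite coord6Z coord6_mul !P3 P5 -/X -/Y in q315.
clear - A0 c0 q102 q103 q104 q105 q112 q115 q015 q215 q315.
rewrite {}/A {}/c in A0 c0.
move: (X 0%N) (X 1%N) (X 2%N) (X 3%N) (X 4%N)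
  (Y 0%N) (Y 1%N) (Y 2%N) (Y 3%N) (Y 4%N) A0 c0
  q102 q103 q104 q105 q112 q115 q015 q215 q315.
(* From here [A], [B], [a2], ... are the coordinates of the image of e_0 and [b0], [b1], ... those
   of the image of e_1, so that c = A + B. *)
move=> {X Y} A B a2 a3 a4 b0 b1 b2 b3 b4 A0 c0.
move=> q102 q103 q104 q105 q112 q115 q015 q215 q315.
have cE := mulIf A0 q102.
(* The image of e_1 e_1 has e_2 coordinate c b0, and it must vanish because e_1 e_1 lies in the span
   of e_3, e_4, e_5. *)
have b00 : b0 = 0.
  by apply: (mulfI c0); rewrite cE -q112 mulr0.
subst b0; rewrite add0r in cE; subst b1.
rewrite ?(add0r, mul0r) in q103 q104 q105 q115 q015 q215 q315.
have E2 : b2 = a2 by apply: (mulIf A0); apply: (addIr _ (esym q103)).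
subst b2.
have E3 : b3 = a3.
  apply: (mulIf A0); apply: (addIr ((A + B) * B * t4 + a2 * B * t3)).
  by rewrite !addrA.
subst b3.
have E4 : b4 = a4 + B * (th - t5).
  apply: (mulIf A0); apply/eqP; rewrite -subr_eq0; apply/eqP.
  move/eqP: q105; rewrite -subr_eq0 => /eqP E.
  by rewrite -[RHS]oppr0 -[in RHS]E; ring.
subst b4.
(* A^4 (A + B) is the coefficient by which e_5 is scaled; it multiplies the unknown parameter in
   each of the four equations. *)
have cancel x y : (x - y) * (A ^+ 4 * (A + B)) = 0 -> x = y.
  have nz : A ^+ 4 * (A + B) != 0 by rewrite mulf_neq0 ?expf_neq0.
  by move/eqP; rewrite mulf_eq0 (negPf nz) orbF subr_eq0 => /eqP.
have H3 : s3 = (A + B) * t3 / A ^+ 2.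
  apply: cancel; move/eqP: q315; rewrite -subr_eq0 => /eqP <-; by field.
subst s3.
have H4 : s4 = (A + B) * (A * t4 - 2 * B * t3 ^+ 2) / A ^+ 4.
  apply: cancel; move/eqP: q215; rewrite -subr_eq0 => /eqP <-; by field.
subst s4.
have H5 : s5 = (A + B) / A ^+ 6 *
    (A ^+ 2 * t5 - 5 * A * B * t3 * t4 + 5 * B ^+ 2 * t3 ^+ 3).
  apply: cancel; move/eqP: q115; rewrite -subr_eq0 => /eqP <-; by field.
have H6 : sh = s5 + (th - t5) / A ^+ 3.
  apply: cancel; rewrite H5; move/eqP: q015.
  rewrite -subr_eq0 => /eqP <-; by field.
exists A, (A + B); split=> //; rewrite /FL_base_change H6 H5.
have -> : A + B - A = B by ring.
by congr (_, _, _, _); field.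
Qed.

(** * Existence of a normal form *)

Lemma exists_nth_root {C : numClosedFieldType} n (z : C) :
  (0 < n)%N -> z != 0 -> exists2 A : C, A != 0 & A ^+ n = z.
Proof.
move=> n0 z0; exists (n.-root z); last exact: rootCK.
by rewrite rootC_eq0.
Qed.

(** The cases follow the vanishing of alpha_3, w, u and d. Passing from t to s multiplies alpha_3 by
    c / A^2, w by c / A^3, d by 1 / A^3 and, when alpha_3 w = 0, u by c / A^4; each witness (A, c)
    solves these equations for the chosen representative t. *)
Lemma FL_rep_exists (C : numClosedFieldType) (s3 s4 s5 sh : C) :
  exists t : FLeib6_index C, leib_iso (FL s3 s4 s5 sh) (FLeib6_rep t).
Proof.
have n5 : 5 != 0 :> C by rewrite pnatr_eq0.
have n2 : 2 != 0 :> C by rewrite pnatr_eq0.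
pose d := sh - s5; have -> : sh = s5 + d by rewrite /d addrC subrK.
move: d => {sh} d.
have [->|s30] := eqVneq s3 0.
  have [->|s40] := eqVneq s4 0.
    have [->|s50] := eqVneq s5 0.
      have [->|d0] := eqVneq d 0.
        exists (Alg11 C).
        apply: (@FL_base_change_iso _ 1 1); rewrite ?oner_eq0 //.
        by rewrite /FL_base_change; congr (_, _, _, _); field.
      have [A A0 AE] := exists_nth_root 3 d^-1 isT (invr_neq0 d0).
      exists (Alg10 C).
      apply: (@FL_base_change_iso _ A 1); rewrite ?oner_eq0 //.
      (* Eliminating [d] in favour of [A] turns the root condition into rational identities for
         [field]. *)
      have -> : d = 1 / A ^+ 3 by rewrite AE; field; rewrite ?oner_eq0 ?d0.
      by rewrite /FL_base_change; congr (_, _, _, _); field; rewrite ?A0.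
    have [->|d0] := eqVneq d 0.
      exists (Alg9 C).
      apply: (@FL_base_change_iso _ 1 s5); rewrite ?oner_eq0 //.
      by rewrite /FL_base_change; congr (_, _, _, _); field.
    have [|A A0 AE] := exists_nth_root 3 (- d^-1) isT _.
      by rewrite oppr_eq0 invr_neq0.
    exists (Alg8 C); apply: (@FL_base_change_iso _ A (s5 * A ^+ 4)) => //.
      by rewrite mulf_neq0 ?expf_neq0.
    have -> : d = - 1 / A ^+ 3.
      by rewrite AE; field; rewrite ?oppr_eq0 ?oner_eq0 ?d0.
    by rewrite /FL_base_change; congr (_, _, _, _); field; rewrite ?A0.
  have [->|s50] := eqVneq s5 0.
    have [->|d0] := eqVneq d 0.
      exists (Alg7 C).
      apply: (@FL_base_change_iso _ 1 s4); rewrite ?oner_eq0 //.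
      by rewrite /FL_base_change; congr (_, _, _, _); field.
    have [A A0 AE] := exists_nth_root 3 d^-1 isT (invr_neq0 d0).
    exists (Alg6 C); apply: (@FL_base_change_iso _ A (s4 * A ^+ 3)) => //.
      by rewrite mulf_neq0 ?expf_neq0.
    have -> : d = 1 / A ^+ 3 by rewrite AE; field; rewrite ?oner_eq0 ?d0.
    by rewrite /FL_base_change; congr (_, _, _, _); field; rewrite ?A0.
  (* Both w and u must be 1 in the target: s4 A^3 = c = s5 A^4. *)
  have A0 : s4 / s5 != 0 by rewrite mulf_neq0 ?invr_neq0.
  exists (Fam3 (1 + d * (s4 / s5) ^+ 3)).
  apply: (@FL_base_change_iso _ (s4 / s5) (s4 * (s4 / s5) ^+ 3)) => //.
    by rewrite mulf_neq0 ?expf_neq0.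
  by rewrite /FL_base_change; congr (_, _, _, _); field; rewrite ?s40 ?s50.
have [s4E|s40] := eqVneq (s4 + 2 * s3 ^+ 2) 0.
  have {}s4E : s4 = - (2 * s3 ^+ 2) by apply/eqP; rewrite -addr_eq0 s4E.
  pose u := s5 - 5 * s3 ^+ 3.
  have -> : s5 = u + 5 * s3 ^+ 3 by rewrite subrK.
  rewrite s4E; move: u => {s4 s4E s5} u.
  have c0 A : A != 0 -> s3 * A ^+ 2 != 0.
    by move=> A0; rewrite mulf_neq0 ?expf_neq0.
  have [->|u0] := eqVneq u 0; have [->|d0] := eqVneq d 0.
  (* In [Fam2] both u and d equal lambda - 5, so u = d = 0 is the member lambda = 5. *)
  - exists (Fam2 5).
    apply: (@FL_base_change_iso _ 1 (s3 * 1 ^+ 2)); rewrite ?c0 ?oner_eq0 //.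
    by rewrite /FL_base_change; congr (_, _, _, _); field.
  - have [|A A0 AE] := exists_nth_root 3 (- (5 / d)) isT _.
      by rewrite oppr_eq0 mulf_neq0 ?invr_neq0.
    exists (Alg5 _).
    apply: (@FL_base_change_iso _ A (s3 * A ^+ 2)); rewrite ?c0 //.
    have -> : d = - 5 / A ^+ 3 by rewrite AE; field; rewrite ?oppr_eq0 ?n5 ?d0.
    by rewrite /FL_base_change; congr (_, _, _, _); field; rewrite ?A0.
  - have [|A A0 AE] := exists_nth_root 2 (- (5 * s3 / u)) isT _.
      by rewrite oppr_eq0 !mulf_neq0 ?invr_neq0.
    exists (Alg4 _).
    apply: (@FL_base_change_iso _ A (s3 * A ^+ 2)); rewrite ?c0 //.
    have -> : u = - (5 * s3) / A ^+ 2.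
      by rewrite AE; field; rewrite ?oppr_eq0 ?n5 ?u0 ?s30.
    by rewrite /FL_base_change; congr (_, _, _, _); field; rewrite ?A0.
  (* With c = s3 A^2 the targets of u and d are u A^2 / s3 and d A^3; [Fam2] requires them to be
     equal. *)
  have A0 : u / (s3 * d) != 0 by rewrite mulf_neq0 ?invr_neq0 ?mulf_neq0.
  exists (Fam2 (5 + u ^+ 3 / (s3 ^+ 3 * d ^+ 2))).
  apply: (@FL_base_change_iso _ (u / (s3 * d)) (s3 * (u / (s3 * d)) ^+ 2));
    rewrite ?c0 //.
  by rewrite /FL_base_change; congr (_, _, _, _); field; rewrite ?u0 ?d0 ?s30.
(* The target has alpha_3 = 1 and w = 2, hence c = s3 A^2 and w A^3 = 2 c. *)
pose A := 2 * s3 / (s4 + 2 * s3 ^+ 2).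
have A0 : A != 0 by rewrite !mulf_neq0 ?invr_neq0.
have s4E : s4 = 2 * s3 / A - 2 * s3 ^+ 2.
  by rewrite /A; field; rewrite ?s40 ?s30 ?n2.
clearbody A; rewrite s4E.
(* The formula for [s5] in [FL_base_change], solved for [t5] at t3 = 1, t4 = 0. *)
pose l := (s5 * A ^+ 4 / s3 - 5 * (s3 * A ^+ 2 - A) ^+ 2) / A ^+ 2.
exists (Fam1 l (l + d * A ^+ 3)).
apply: (@FL_base_change_iso _ A (s3 * A ^+ 2)) => //.
  by rewrite mulf_neq0 ?expf_neq0.
by rewrite /FL_base_change /l; congr (_, _, _, _); field; rewrite ?A0 ?s30.
Qed.

(** * Pairwise non-isomorphism of the representatives *)

(** The shift 2 alpha_3^2 absorbs the term in c - A of alpha_4; the shift -5 alpha_3^3 leaves in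
    alpha_5 only one such term, a multiple of alpha_3 w. *)
Lemma FL_base_change_relations (K : fieldType)
    (A c s3 s4 s5 sh t3 t4 t5 th : K) : A != 0 ->
  (s3, s4, s5, sh) = FL_base_change A c t3 t4 t5 th ->
  [/\ s3 * A ^+ 2 = c * t3,
      (s4 + 2 * s3 ^+ 2) * A ^+ 3 = c * (t4 + 2 * t3 ^+ 2),
      (sh - s5) * A ^+ 3 = th - t5
    & (s5 - 5 * s3 ^+ 3) * A ^+ 6 =
      c * (A ^+ 2 * (t5 - 5 * t3 ^+ 3)
           - 5 * A * (c - A) * (t3 * (t4 + 2 * t3 ^+ 2)))].
Proof. by move=> A0 [-> -> -> ->]; split; field. Qed.

(* rep_w, rep_u and rep_d are the values of alpha_4 + 2 alpha_3^2,
   alpha_5 - 5 alpha_3^3 and theta - alpha_5 (see FLeib6_rep_FL). *)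
Section RepInvariants.
Variables (K : fieldType) (t : FLeib6_index K).

Definition rep_alpha3 : K :=
  match t with Fam1 _ _ | Fam2 _ | Alg4 | Alg5 => 1 | _ => 0 end.

Definition rep_w : K :=
  match t with Fam1 _ _ => 2 | Fam3 _ | Alg6 | Alg7 => 1 | _ => 0 end.

Definition rep_u : K :=
  match t with
  | Fam1 l _ | Fam2 l => l - 5
  | Alg4 => - 5
  | Fam3 _ | Alg8 | Alg9 => 1
  | _ => 0
  end.

Definition rep_d : K :=
  match t with
  | Fam1 l1 l2 => l2 - l1
  | Fam2 l => l - 5
  | Fam3 l => l - 1
  | Alg5 => - 5
  | Alg6 | Alg10 => 1
  | Alg8 => - 1
  | _ => 0
  end.

(** Puts all representatives in one form, so that the relations are derived once rather than for
    every pair. *)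
Lemma FLeib6_rep_FL : exists a4 a5 th,
  [/\ FLeib6_rep t = FL rep_alpha3 a4 a5 th, a4 + 2 * rep_alpha3 ^+ 2 = rep_w,
      a5 - 5 * rep_alpha3 ^+ 3 = rep_u & th - a5 = rep_d].
Proof.
by rewrite /rep_alpha3 /rep_w /rep_u /rep_d; case: t => [l1 l2|l|l||||||||];
  do 3 eexists; split; try reflexivity; ring.
Qed.
End RepInvariants.

Lemma FLeib6_rep_relations (K : fieldType) (s t : FLeib6_index K) :
  leib_iso (FLeib6_rep s) (FLeib6_rep t) ->
  exists A c : K, [/\ A != 0, c != 0,
    rep_alpha3 _ s * A ^+ 2 = c * rep_alpha3 _ t,
    rep_w _ s * A ^+ 3 = c * rep_w _ t
  & rep_d _ s * A ^+ 3 = rep_d _ t /\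
    rep_u _ s * A ^+ 6 = c * (A ^+ 2 * rep_u _ t
             - 5 * A * (c - A) * (rep_alpha3 _ t * rep_w _ t))].
Proof.
have [s4 [s5 [sh [-> <- <- <-]]]] := FLeib6_rep_FL _ s.
have [t4 [t5 [th [-> <- <- <-]]]] := FLeib6_rep_FL _ t.
case/FL_iso_base_change=> A [c [A0 c0]].
case/(FL_base_change_relations _ _ _ _ _ _ _ _ _ _ _ A0)=> E3 Ew Ed Eu.
by exists A, c.
Qed.

Lemma FLeib6_rep_inj (C : numFieldType) (s t : FLeib6_index C) :
  leib_iso (FLeib6_rep s) (FLeib6_rep t) -> s = t.
Proof.
case/FLeib6_rep_relations=> A [c [A0 c0]].
have simp := (mulr0, mul0r, mulr1, mul1r, oppr0, subr0).
have nz :=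
  (mulf_eq0, expf_eq0, oppr_eq0, oner_eq0, pnatr_eq0, negPf A0, negPf c0).
case: s t => [l1 l2|l|l||||||||] [m1 m2|m|m||||||||] //;
  rewrite /rep_alpha3 /rep_w /rep_d /rep_u => E3 Ew [Ed Eu];
  rewrite ?simp in E3 Ew Ed Eu;
  (* Most pairs of different types equate 0 with a nonzero product of A, c and integer constants in
     one of the relations. *)
  try (by move/eqP: E3; rewrite 1?[0 == _]eq_sym ?nz);
  try (by move/eqP: Ew; rewrite 1?[0 == _]eq_sym ?nz);
  try (by move/eqP: Ed; rewrite 1?[0 == _]eq_sym ?nz);
  try (by move/eqP: Eu; rewrite 1?[0 == _]eq_sym ?nz).
- have A1 : A = 1.
    (* Here A^2 = c and 2 A^3 = 2 c, so A = c = 1 and the mixed term of [Eu] disappears. *)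
    have nzA : 2 * A ^+ 2 != 0 by rewrite !nz.
    by apply: (mulfI nzA); rewrite mulr1 [RHS]mulrC [in RHS]E3 -Ew; ring.
  move: E3 Ed Eu; rewrite A1 !expr1n => <-.
  rewrite subrr !(mulr0, mul0r) subr0 !simp => El /addIr l1E.
  by rewrite l1E in El *; rewrite (addIr _ El).
(* At l = 5 the relation [Ed] alone gives m = 5. Otherwise c = A^2 and the relations for u and d
   yield (l - 5) A^6 = (l - 5) A^7. *)
- have [l5|l5] := eqVneq (l - 5) 0.
    by move: Ed; rewrite l5 mul0r -l5 => /addIr ->.
  have A1 : A = 1.
    apply: (mulfI l5); apply: (mulIf (expf_neq0 6 A0)).
    by rewrite mulr1 Eu -Ed -E3; ring.
  by move: Ed; rewrite A1 expr1n mulr1 => /addIr ->.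
(* [Fam2] against [Alg4] or [Alg5], and the converse at the end: a zero of u or d on one side forces
   the parameter 5, where u = d = 0, but [Alg4] has u = -5 and [Alg5] has d = -5. *)
- by move/eqP: Ed; rewrite !nz !orbF => /eqP l5; move/eqP: Eu;
     rewrite l5 mul0r 1?[0 == _]eq_sym !nz.
- by move/eqP: Eu; rewrite !nz !orbF => /eqP l5; move/eqP: Ed;
     rewrite l5 mul0r 1?[0 == _]eq_sym !nz.
- have A1 : A = 1.
    apply: (mulfI (expf_neq0 5 A0)); rewrite mulr1.
    by rewrite -exprSr Eu -Ew -exprD.
  by move: Ed; rewrite A1 expr1n mulr1 => /addIr ->.
- by move: Eu; rewrite -Ed !simp => /eqP; rewrite !nz.
- by move: Ed; rewrite -(mulr1 (m - 5)) => Ed; move/eqP: Eu;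
     rewrite 1?[0 == _]eq_sym !nz => /eqP m5;
     move/eqP: Ed; rewrite m5 mul0r !nz.
Qed.

Theorem theorem2p2p5 (R : realType) :
  (forall L : leibnizAlgType R[i],
     ~ is_lie L -> filiform 6 L -> in_FLeib6 L ->
     exists t : FLeib6_index R[i], leib_iso L (FLeib6_rep t)) /\
  (forall s t : FLeib6_index R[i],
     leib_iso (FLeib6_rep s) (FLeib6_rep t) -> s = t).
Proof.
split=> [L _ _ [a3 [a4 [a5 [th Liso]]]]|s t]; last exact: FLeib6_rep_inj.
have [t tiso] := FL_rep_exists _ a3 a4 a5 th.
by exists t; apply: leib_iso_trans Liso tiso.
Qed.
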